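(* Assume that the problem has no bound constraints, i.e. consider minimizing $f+h$ over $\mathbb R^n$. Consider a run of the trust-region algorithm described in the context, with its stopping test ignored, and with $\nu_k=\alpha\Delta_k/(1+\|B_k\|(1+\alpha\Delta_k))$ at every iteration. Assume that: (i) there is $\kappa_{\mathrm{mdc}}\in(0,1)$ such that $m(0;x_k,B_k)-m(s_k;x_k,B_k)\ge\kappa_{\mathrm{mdc}}\,\xi_{\mathrm{cp}}(\Delta_k;x_k,\nu_k)$ for all $k$; (ii) there is $\kappa_{\mathrm{ubd}}>0$ such that $|(f+h)(x_k+s_k)-m(s_k;x_k,B_k)|\le\kappa_{\mathrm{ubd}}(1+\|B_k\|)\|s_k\|^2$ for all $k$; (iii) there are $\mu>0$ and $0<p<1$ such that $\max_{0\le j\le k}\|B_j\|\le\mu(1+\sigma_k^p)$ for all $k\in\mathbb N$; (iv) infinitely many iterations are successful, and $\mu+1\le\mu|S(\epsilon)|^p$ for all sufficiently small $\epsilon\in(0,1)$; (v) $(f+h)(x_k)$ is bounded below over $k\in\mathbb N$. Let $N\subseteq\mathbb N$ be an infinite index set such that $\{\nu_k^{-1/2}\xi_{\mathrm{cp}}(\Delta_k;x_k,\nu_k)^{1/2}\}_{k\in N}\to0$, $\{\nu_k^{-1}s_{k,1}\}_{k\in N}\to0$, $\{s_{k,1}\}_{k\in N}\to0$ and $\{s_k\}_{k\in N}\to0$. Let $N_1\subseteq N$ be infinite with $\{\nu_k\}_{k\in N_1}\to\bar\nu>0$, and let $\{x_k\}_{k\in N_1}\to\bar x$. Assume that the epigraphical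 limit $$\overline\psi:=\operatorname{e-lim}_{k\in N_1}\psi(\cdot;x_k)$$ exists, is proper lsc, and satisfies $\overline\psi(0)=h(\bar x)$ and $\partial\overline\psi(0)\subseteq\partial h(\bar x)$. Assume further that $-\infty<\inf\overline\psi<+\infty$, and that $\lim_{k\in N_1}\psi(s;x_k)=\overline\psi(s)$ for all $s\in\mathbb R^n$. Then $\bar x$ is stationary for the problem of minimizing $f+h$, i.e. $0\in\nabla f(\bar x)+\partial h(\bar x)$.
   Context: Norms and notation: $\|\cdot\|$ is the Euclidean norm on $\mathbb R^n$ and the induced spectral norm on matrices; $\overline{\mathbb R}=\mathbb R\cup\{\pm\infty\}$. Problem: minimize $f(x)+h(x)$ over $x\in\mathbb R^n$, where $f:\mathbb R^n\to\mathbb R$ is continuously differentiable and $h:\mathbb R^n\to\mathbb R\cup\{+\infty\}$ is proper and lower semicontinuous (lsc). Both may be nonconvex. Subdifferential: for $\phi:\mathbb R^n\to\overline{\mathbb R}$ finite at $\bar x$, $\widehat\partial\phi(\bar x)$ is the set of $v$ with $\liminf_{x\to\bar x,x\ne\bar x}\frac{\phi(x)-\phi(\bar x)-v^T(x-\bar x)}{\|x-\bar x\|}\ge0$; $\partial\phi(\bar x)$ is the set of $v$ for which there are $x_k\to\bar x$, $v_k\to v$ with $\phi(x_k)\to\phi(\bar x)$ and $v_k\in\widehat\partial\phi(x_k)$. Epi-limits: $\operatorname{epi}\phi=\{(t,x)\mid t\ge\phi(x)\}\subseteq\mathbb R\times\mathbb R^n$. For sets $A_k$, $\limsup_kA_k$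 is the set of limits of convergent subsequences $\{y_k\}_{k\in K}$, $K$ infinite, with $y_k\in A_k$ for $k\in K$; $\liminf_kA_k$ is the set of limits of sequences $\{y_k\}$ with $y_k\in A_k$ for all large $k$. The lower and upper epi-limits of $\{\phi_k\}$ are the functions whose epigraphs are $\limsup_k\operatorname{epi}\phi_k$ and $\liminf_k\operatorname{epi}\phi_k$ respectively; when they coincide, the common function is the epigraphical limit $\operatorname{e-lim}_k\phi_k$. Models: for every $x$ where $h$ is finite, a model $\psi(\cdot;x):\mathbb R^n\to\overline{\mathbb R}$ of $s\mapsto h(x+s)$ is given; it is assumed proper lsc with $\psi(0;x)=h(x)$ and $\partial\psi(0;x)\subseteq\partial h(x)$. Set $\varphi_{\mathrm{cp}}(s;x)=f(x)+\nabla f(x)^Ts$, $m_{\mathrm{cp}}(s;x,\nu)=\varphi_{\mathrm{cp}}(s;x)+\tfrac12\nu^{-1}\|s\|^2+\psi(s;x)$, and $m(s;x,B)=f(x)+\nabla f(x)^Ts+\tfrac12s^TBs+\psi(s;x)$ with $B=B^T$. Algorithm: constants $0<\eta_1\le\eta_2<1$, $0<1/\gamma_3\le\gamma_1\le\gamma_2<1<\gamma_3\le\gamma_4$, $\Delta_{\max}>\Delta_0>0$, $\alpha>0$, $\beta\ge1$, tolerance $\epsilon>0$, and $x_0$ with $h(x_0)$ finite. At iteration $k=0,1,\dots$, with a symmetric matrix $B_k$: (1) choose $0<\nu_k\le\frac{\alpha\Delta_k}{1+\|B_k\|(1+\alpha\Delta_k)}$; (2) compute $s_{k,1}\in\operatorname{argmin}_{\|s\|\le\Delta_k}m_{\mathrm{cp}}(s;x_k,\nu_k)$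 and let $\xi_{\mathrm{cp}}(\Delta_k;x_k,\nu_k)=f(x_k)+h(x_k)-\varphi_{\mathrm{cp}}(s_{k,1};x_k)-\psi(s_{k,1};x_k)$; (3) stopping test: terminate if $\nu_k^{-1/2}\xi_{\mathrm{cp}}(\Delta_k;x_k,\nu_k)^{1/2}\le\epsilon$; (4) compute an approximate minimizer $s_k$ of $m(\cdot;x_k,B_k)$ subject to $\|s\|\le\min(\Delta_k,\beta\|s_{k,1}\|)$, meaning a feasible $s_k$ with $m(s_k;x_k,B_k)\le m(s_{k,1};x_k,B_k)$; (5) compute $\rho_k=\frac{(f+h)(x_k)-(f+h)(x_k+s_k)}{m(0;x_k,B_k)-m(s_k;x_k,B_k)}$; set $x_{k+1}=x_k+s_k$ if $\rho_k\ge\eta_1$ and $x_{k+1}=x_k$ otherwise; (6) choose $\bar\Delta_{k+1}\in[\gamma_3\Delta_k,\gamma_4\Delta_k]$ if $\rho_k\ge\eta_2$ (very successful), in $[\gamma_2\Delta_k,\Delta_k]$ if $\eta_1\le\rho_k<\eta_2$, in $[\gamma_1\Delta_k,\gamma_2\Delta_k]$ if $\rho_k<\eta_1$ (unsuccessful); set $\Delta_{k+1}=\min(\bar\Delta_{k+1},\Delta_{\max})$. Iteration $k$ is successful if $\rho_k\ge\eta_1$. $\sigma_k=|\{j=0,\dots,k\mid\rho_j\ge\eta_1\}|$. For $0<\epsilon<1$, $k_\epsilon$ is the first iteration with $\nu_k^{-1/2}\xi_{\mathrm{cp}}(\Delta_k;x_k,\nu_k)^{1/2}\le\epsilon$ ($k_\epsilon=\infty$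 if there is none), and $S(\epsilon)=\{k=0,\dots,k_\epsilon-1\mid\rho_k\ge\eta_1\}$. *)

(* Defs.v *)
From HB Require Import structures.
From mathcomp Require Export all_boot all_order all_algebra.
From mathcomp Require Export all_classical all_reals all_analysis.
Export Order.TTheory GRing.Theory Num.Theory.
Export numFieldNormedType.Exports.

Set Implicit Arguments.
Unset Strict Implicit.
Unset Printing Implicit Defensive.

Local Open Scope classical_set_scope.
Local Open Scope ring_scope.

(* The library norm on 'cV[R]_n is the sup norm (it induces the usual
   topology); the Euclidean and spectral norms are therefore defined here. *)
Definition dotv (R : realType) (n : nat) (u v : 'cV[R]_n) : R :=
  (u^T *m v) 0 0.

Definition enorm (R : realType) (n : nat) (v : 'cV[R]_n) : R :=
  Num.sqrt (dotv v v).

Definition specnorm (R : realType) (n : nat) (B : 'M[R]_n) : R :=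
  sup [set enorm (B *m v) | v in [set v : 'cV[R]_n | enorm v <= 1]].

Definition grad (R : realType) (n : nat) (f : 'cV[R]_n -> R) (x : 'cV[R]_n) :
    'cV[R]_n :=
  \col_i 'D_(delta_mx i 0) f x.

Definition continuously_differentiable (R : realType) (n : nat)
    (f : 'cV[R]_n -> R) : Prop :=
  (forall x, differentiable f x) /\ continuous (grad f).

Definition proper (R : realType) (n : nat) (phi : 'cV[R]_n -> \bar R) : Prop :=
  (forall x, -oo < phi x)%E /\ (exists x, phi x < +oo)%E.

(* Both subdifferentials are empty at points where phi is not finite. *)
Definition regular_subdiff (R : realType) (n : nat)
    (phi : 'cV[R]_n -> \bar R) (xbar : 'cV[R]_n) : set 'cV[R]_n :=
  [set v | phi xbar \is a fin_num /\
    (0 <= limf_einf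
       (fun x => (phi x - phi xbar - (dotv v (x - xbar))%:E)
                 / (enorm (x - xbar))%:E)
       xbar^')%E].

Definition limiting_subdiff (R : realType) (n : nat)
    (phi : 'cV[R]_n -> \bar R) (xbar : 'cV[R]_n) : set 'cV[R]_n :=
  [set v | phi xbar \is a fin_num /\
    exists x_ v_ : nat -> 'cV[R]_n,
      [/\ x_ @ \oo --> xbar, v_ @ \oo --> v,
          (fun k => phi (x_ k)) @ \oo --> phi xbar &
          forall k, regular_subdiff phi (x_ k) (v_ k)]].

Definition epi (R : realType) (n : nat) (phi : 'cV[R]_n -> \bar R) :
    set (R * 'cV[R]_n) :=
  [set tx | (phi tx.2 <= tx.1%:E)%E].

(* Outer and inner limits of the sets A k as k tends to infinity in N. *)
Definition limsup_set (T : topologicalType) (N : set nat) (A : nat -> set T) :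
    set T :=
  [set y | exists (K : set nat) (u : nat -> T),
     [/\ infinite_set K, K `<=` N, (forall k, K k -> A k (u k)) &
         u @ within K \oo --> y]].

Definition liminf_set (T : topologicalType) (N : set nat) (A : nat -> set T) :
    set T :=
  [set y | exists u : nat -> T,
     (\forall k \near within N \oo, A k (u k)) /\ u @ within N \oo --> y].

Definition is_lower_epi_limit (R : realType) (n : nat) (N : set nat)
    (phi_ : nat -> 'cV[R]_n -> \bar R) (phi : 'cV[R]_n -> \bar R) : Prop :=
  epi phi = limsup_set N (fun k => epi (phi_ k)).

Definition is_upper_epi_limit (R : realType) (n : nat) (N : set nat)
    (phi_ : nat -> 'cV[R]_n -> \bar R) (phi : 'cV[R]_n -> \bar R) : Prop :=
  epi phi = liminf_set N (fun k => epi (phi_ k)).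

Definition is_epi_limit (R : realType) (n : nat) (N : set nat)
    (phi_ : nat -> 'cV[R]_n -> \bar R) (phi : 'cV[R]_n -> \bar R) : Prop :=
  is_lower_epi_limit N phi_ phi /\ is_upper_epi_limit N phi_ phi.

Section Models.
Context {R : realType} {n : nat}.
Implicit Types (f : 'cV[R]_n -> R) (h : 'cV[R]_n -> \bar R).
Implicit Types (psi : 'cV[R]_n -> 'cV[R]_n -> \bar R).

Definition objective f h (x : 'cV[R]_n) : \bar R := ((f x)%:E + h x)%E.

Definition stationary f h (x : 'cV[R]_n) : Prop :=
  [set grad f x + v | v in limiting_subdiff h x] 0.

(* psi x s stands for the value at s of the model of h about x. *)
Definition is_model h psi : Prop :=
  forall x, h x \is a fin_num ->
    [/\ proper (psi x), lower_semicontinuous (psi x), psi x 0 = h x &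
        limiting_subdiff (psi x) 0 `<=` limiting_subdiff h x].

Definition phi_cp f (x s : 'cV[R]_n) : R := f x + dotv (grad f x) s.

Definition m_cp f psi (x : 'cV[R]_n) (nu : R) (s : 'cV[R]_n) : \bar R :=
  ((phi_cp f x s + 2^-1 * nu^-1 * enorm s ^+ 2)%:E + psi x s)%E.

Definition m_quad f psi (x : 'cV[R]_n) (B : 'M[R]_n) (s : 'cV[R]_n) : \bar R :=
  ((f x + dotv (grad f x) s + 2^-1 * dotv s (B *m s))%:E + psi x s)%E.

End Models.

Record tr_params (R : realType) := TRParams {
  eta1 : R; eta2 : R;
  gamma1 : R; gamma2 : R; gamma3 : R; gamma4 : R;
  Delta0 : R; Delta_max : R; alpha : R; beta : R;
  eta1_gt0 : 0 < eta1;
  eta1_le_eta2 : eta1 <= eta2;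
  eta2_lt1 : eta2 < 1;
  gamma3V_gt0 : 0 < gamma3^-1;
  gamma3V_le_gamma1 : gamma3^-1 <= gamma1;
  gamma1_le_gamma2 : gamma1 <= gamma2;
  gamma2_lt1 : gamma2 < 1;
  gamma3_gt1 : 1 < gamma3;
  gamma3_le_gamma4 : gamma3 <= gamma4;
  Delta0_gt0 : 0 < Delta0;
  Delta0_lt_max : Delta0 < Delta_max;
  alpha_gt0 : 0 < alpha;
  beta_ge1 : 1 <= beta
}.

Record tr_iterates (R : realType) (n : nat) := TRIterates {
  xk : nat -> 'cV[R]_n;
  Bk : nat -> 'M[R]_n;
  Deltak : nat -> R;
  nuk : nat -> R;
  s1k : nat -> 'cV[R]_n;
  sk : nat -> 'cV[R]_n;
  rhok : nat -> \bar R
}.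

Section Algorithm.
Context {R : realType} {n : nat}.
Implicit Types (f : 'cV[R]_n -> R) (h : 'cV[R]_n -> \bar R).
Implicit Types (psi : 'cV[R]_n -> 'cV[R]_n -> \bar R).
Implicit Types (P : tr_params R) (it : tr_iterates R n).

Definition nu_bound P it (k : nat) : R :=
  alpha P * Deltak it k
  / (1 + specnorm (Bk it k) * (1 + alpha P * Deltak it k)).

Definition xi_cp f h psi it (k : nat) : \bar R :=
  ((f (xk it k))%:E + h (xk it k) - (phi_cp f (xk it k) (s1k it k))%:E
   - psi (xk it k) (s1k it k))%E.

(* In a run, xi_cp is a nonnegative real, so that fine loses nothing. *)
Definition criticality f h psi it (k : nat) : R :=
  (Num.sqrt (nuk it k))^-1 * Num.sqrt (fine (xi_cp f h psi it k)).

Definition pred_decrease f psi it (k : nat) : \bar R :=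
  (m_quad f psi (xk it k) (Bk it k) 0
   - m_quad f psi (xk it k) (Bk it k) (sk it k))%E.

Definition successful P it (k : nat) : bool := ((eta1 P)%:E <= rhok it k)%E.

(* A run without stopping test. The ratio rhok may be -oo, namely when h takes
   the value +oo at the trial point; it is left unconstrained when its
   denominator vanishes. *)
Record tr_run f h psi P it : Prop := TRRun {
  run_x0 : h (xk it 0) \is a fin_num;
  run_Delta0 : Deltak it 0 = Delta0 P;
  run_B : forall k, (Bk it k)^T = Bk it k;
  run_nu : forall k, 0 < nuk it k <= nu_bound P it k;
  run_s1_feasible : forall k, enorm (s1k it k) <= Deltak it k;
  run_s1_argmin : forall k s, enorm s <= Deltak it k ->
    (m_cp f psi (xk it k) (nuk it k) (s1k it k)
     <= m_cp f psi (xk it k) (nuk it k) s)%E;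
  run_s_feasible : forall k,
    enorm (sk it k) <= Num.min (Deltak it k) (beta P * enorm (s1k it k));
  run_s_decrease : forall k,
    (m_quad f psi (xk it k) (Bk it k) (sk it k)
     <= m_quad f psi (xk it k) (Bk it k) (s1k it k))%E;
  run_rho : forall k, pred_decrease f psi it k != 0%E ->
    rhok it k = ((objective f h (xk it k)
                  - objective f h (xk it k + sk it k))
                 / pred_decrease f psi it k)%E;
  run_x : forall k, xk it k.+1 =
    if successful P it k then xk it k + sk it k else xk it k;
  run_Delta : forall k, exists Dbar : R,
    [/\ ((eta2 P)%:E <= rhok it k)%E ->
          gamma3 P * Deltak it k <= Dbar <= gamma4 P * Deltak it k,
        ((eta1 P)%:E <= rhok it k < (eta2 P)%:E)%E ->
          gamma2 P * Deltak it k <= Dbar <= Deltak it k,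
        (rhok it k < (eta1 P)%:E)%E ->
          gamma1 P * Deltak it k <= Dbar <= gamma2 P * Deltak it k &
        Deltak it k.+1 = Num.min Dbar (Delta_max P)]
}.

Definition sigma P it (k : nat) : nat :=
  #|[set j : 'I_k.+1 | successful P it j]%SET|.

(* First iteration with criticality at most eps, as an extended real;
   the infimum is +oo when there is none. *)
Definition k_eps f h psi it (eps : R) : \bar R :=
  ereal_inf [set (k%:R)%:E | k in [set k | criticality f h psi it k <= eps]].

Definition S_eps f h psi P it (eps : R) : set nat :=
  [set k | ((k%:R)%:E < k_eps f h psi it eps)%E /\ successful P it k].

End Algorithm.

(* Main.v *)
(* Since s_{k,1} minimizes the Cauchy model over the ball of radius Delta_k, for
   all |s| <= Delta_k
     h(x_k) <= xi_k + grad f(x_k).s + |s|^2 / (2 nu_k) + psi(s; x_k),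
   where xi_k = nu_k crit_k^2 tends to 0 along N1, and Delta_k >= nu_k / alpha
   stays bounded away from 0. Pointwise convergence of the models gives
     psibar(0) <= grad f(xbar).s + |s|^2 / (2 nubar) + psibar(s)
   for all small s, so that - grad f(xbar) is a regular subgradient of psibar
   at 0. The objective is nonincreasing along the run, which makes
   h(xbar) = psibar(0) finite. *)
Require Import Defs.
From mathcomp Require Import lra.

Set Implicit Arguments.
Unset Strict Implicit.
Unset Printing Implicit Defensive.

Local Open Scope classical_set_scope.
Local Open Scope ring_scope.

(** * Euclidean inner product and norm *)

Section EuclideanNorm.
Context {R : realType} {n : nat}.
Implicit Types u v : 'cV[R]_n.

Lemma dotvE u v : dotv u v = \sum_i u i 0 * v i 0.
Proof. by rewrite /dotv mxE; apply: eq_bigr => i _; rewrite mxE. Qed.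

Lemma dotvNl u v : dotv (- u) v = - dotv u v.
Proof. by rewrite /dotv linearN mulNmx mxE. Qed.

Lemma dotvv_ge0 v : 0 <= dotv v v.
Proof. by rewrite dotvE; apply: sumr_ge0 => i _; rewrite -expr2 sqr_ge0. Qed.

Lemma dotv0 u : dotv u 0 = 0.
Proof. by rewrite /dotv mulmx0 mxE. Qed.

Lemma enorm_ge0 v : 0 <= enorm v. Proof. exact: sqrtr_ge0. Qed.

Lemma enorm0 : enorm (0 : 'cV[R]_n) = 0.
Proof. by rewrite /enorm dotv0 sqrtr0. Qed.

Lemma enorm_eq0 v : (enorm v == 0) = (v == 0).
Proof.
apply/idP/eqP => [|->]; last by rewrite enorm0.
rewrite sqrtr_eq0 dotvE => v0.
have {}v0 : \sum_i v i 0 * v i 0 == 0.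
  by rewrite eq_le v0 -dotvE dotvv_ge0.
move: v0; rewrite psumr_eq0; last by move=> i _; rewrite -expr2 sqr_ge0.
move=> /allP v0; apply/matrixP => i j; rewrite ord1 mxE.
by have := v0 i (mem_index_enum _); rewrite /= mulf_eq0 orbb => /eqP.
Qed.

Lemma cvg_dotv {T : Type} (F : set_system T) {FF : Filter F}
    (u_ v_ : T -> 'cV[R]_n) u v :
  u_ @ F --> u -> v_ @ F --> v -> (fun k => dotv (u_ k) (v_ k)) @ F --> dotv u v.
Proof.
move=> cu cv; under eq_fun do rewrite dotvE; rewrite dotvE.
apply: cvg_big => [|i _]; first exact: add_continuous.
by apply: cvgM; [apply: (cvg_comp _ (fun w : 'cV[R]_n => w i 0) cu)
                |apply: (cvg_comp _ (fun w : 'cV[R]_n => w i 0) cv)];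
  exact: coord_continuous.
Qed.

Lemma enorm_continuous : continuous (@enorm R n).
Proof.
move=> v; have vv : (fun u => dotv u u) @ v --> dotv v v.
  by apply: (@cvg_dotv _ (nbhs v)); exact: cvg_id.
by apply: (cvg_comp _ Num.sqrt vv); exact: sqrt_continuous.
Qed.

End EuclideanNorm.

Lemma specnorm_ge0 (R : realType) (n : nat) (B : 'M[R]_n) : 0 <= specnorm B.
Proof.
rewrite /specnorm; set S := (X in sup X).
(* By convention [sup] is 0 when no supremum exists, so boundedness of the image of the unit ball
   need not be shown. *)
have [supS|/sup_out->//] := pselect (has_sup S).
apply: (sup_upper_bound supS); exists 0; first by rewrite /= enorm0 ler01.
by rewrite mulmx0 enorm0.
Qed.

(** A tail of [N] can only be empty if [N] is bounded. Properness is what lets inequalities pass to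
    limits along [N]. *)
Lemma within_infinite_proper (N : set nat) :
  infinite_set N -> ProperFilter (within N \oo).
Proof.
move=> Ninf; apply: Build_ProperFilter => -[M _ MN]; apply: Ninf.
apply: (@sub_finite_set _ _ `I_M); last exact: finite_II.
by move=> k Nk /=; rewrite ltnNge; apply/negP => /MN /(_ Nk).
Qed.

(** * Regular and limiting subgradients *)

Lemma regular_sub_limiting (R : realType) (n : nat)
    (phi : 'cV[R]_n -> \bar R) (x : 'cV[R]_n) :
  regular_subdiff phi x `<=` limiting_subdiff phi x.
Proof.
move=> v vx; split; first by case: vx.
by exists (fun=> x), (fun=> v); split => //; exact: cvg_cst.
Qed.

(** The local quadratic minorant bounds the difference quotient at [y] below by
    [- c * enorm (y - x)], which tends to 0. *)
Lemma regular_subdiff_quadratic (R : realType) (n : nat)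
    (phi : 'cV[R]_n -> \bar R) (x v : 'cV[R]_n) (c d : R) :
  phi x \is a fin_num -> 0 < c -> 0 < d ->
  (forall s, enorm s <= d ->
     (phi x <= (c * enorm s ^+ 2 - dotv v s)%:E + phi (x + s)%R)%E) ->
  regular_subdiff phi x v.
Proof.
move=> phix c0 d0 phiP; split => //.
rewrite limf_einfE; apply/lee_addgt0Pr => e e0.
rewrite -leeBlDr // sub0e.
apply: ereal_sup_ge.
(* The lower limit is a supremum of infima over punctured neighbourhoods, so one with infimum at
   least [- e] suffices; radius [e / c] achieves this. *)
pose V := [set y | y != x /\ enorm (y - x) < Num.min d (e / c)].
exists (ereal_inf [set ((phi y - phi x - (dotv v (y - x))%:E)
                 / (enorm (y - x))%:E)%E | y in V]).
  exists V => //.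
  have ny : \forall y \near x, enorm (y - x) < Num.min d (e / c).
    have m0 : 0 < Num.min d (e / c) by rewrite lt_min d0 divr_gt0.
    have c' : enorm (y - x) @[y --> x] --> (0 : R).
      rewrite -[X in _ --> X](@enorm0 R n) -(subrr x).
      have yx : (fun y => y - x) @ x --> x - x.
        by apply: (@cvgB _ _ _ (nbhs x)); [exact: cvg_id|exact: cvg_cst].
      by apply: (cvg_comp _ (@enorm R n) yx); exact: enorm_continuous.
    exact: (cvgr_lt _ c' _ m0).
  by near=> y; split; [near: y; exact: nbhs_dnbhs_neq | near: y; exact: nbhs_dnbhs].
apply: le_ereal_inf_tmp => _ [y [yx yV] <-].
move: yV; rewrite lt_min => /andP[yd ye].
have y0 : 0 < enorm (y - x).
  by rewrite lt_neqAle enorm_ge0 andbT eq_sym enorm_eq0 subr_eq0.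
have := phiP _ (ltW yd); rewrite [x + _]addrC subrK.
move: ye; rewrite ltr_pdivlMr // => ye.
move: (phi x) phix => [a| |]//= _.
rewrite inver gt_eqF //.
case: (phi y) => [b| |] //=; last first.
  by rewrite !addye // gt0_mulye ?leey // lte_fin invr_gt0.
rewrite -!EFinD -EFinM !lee_fin => h.
rewrite ler_pdivlMr //. nra.
Unshelve. all: by end_near.
Qed.

(** * Cauchy step, descent and step length along a run *)

Section Run.
Context {R : realType} {n : nat} (f : 'cV[R]_n -> R) (h : 'cV[R]_n -> \bar R).
Context (psi : 'cV[R]_n -> 'cV[R]_n -> \bar R).
Context (P : tr_params R) (it : tr_iterates R n).

(** Comparing the minimizer with [s = 0] gives finiteness and the lower bound on [xi]; comparing it
    with an arbitrary feasible [s] gives the last inequality, after dropping the quadratic term of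
    [s1k]. *)
Lemma cauchy_step (k : nat) :
  is_model h psi -> tr_run f h psi P it -> h (xk it k) \is a fin_num ->
  exists xi : R,
    [/\ xi_cp f h psi it k = xi%:E,
        psi (xk it k) (s1k it k) \is a fin_num,
        2^-1 * (nuk it k)^-1 * enorm (s1k it k) ^+ 2 <= xi &
        forall s, enorm s <= Deltak it k ->
          (h (xk it k) <= (xi + dotv (grad f (xk it k)) s
                           + 2^-1 * (nuk it k)^-1 * enorm s ^+ 2)%:E
                          + psi (xk it k) s)%E].
Proof.
move=> /(_ (xk it k)) Hpsi run hfin.
have [[psiNy _] _ psi0 _] := Hpsi hfin.
have argmin := run_s1_argmin run (k := k).
have Delta_ge0 : 0 <= Deltak it k.
  exact: le_trans (enorm_ge0 _) (run_s1_feasible run k).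
have /andP[nu0 _] := run_nu run k.
have := argmin 0; rewrite enorm0 => /(_ Delta_ge0).
have := psiNy (s1k it k); move: argmin.
rewrite /xi_cp /m_cp /phi_cp psi0 enorm0 dotv0.
move: (h (xk it k)) hfin => [a| |] //= _.
move: (psi (xk it k) (s1k it k)) => [b| |] //= argmin _.
rewrite -!EFinD lee_fin => min0.
eexists; split; first reflexivity; [by []|lra|].
move=> s /argmin.
have := psiNy s; move: (psi (xk it k) s) => [c| |] //= _; last first.
  by move=> _; rewrite leey.
rewrite -!EFinD !lee_fin.
have : 0 <= 2^-1 * (nuk it k)^-1 * enorm (s1k it k) ^+ 2.
  by rewrite mulr_ge0 ?sqr_ge0 // mulr_ge0 ?invr_ge0 // ltW.
lra.
Qed.

(** Finiteness of [h] and descent are proved in one induction, since the model at [xk it k] is only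
    controlled where [h] is finite. *)
Lemma objective_nonincreasing (kmdc kubd : R) :
  (forall x, -oo < h x)%E -> is_model h psi -> tr_run f h psi P it ->
  0 < kmdc ->
  (forall k,
    (kmdc%:E * xi_cp f h psi it k <= pred_decrease f psi it k)%E) ->
  (forall k,
    (`|objective f h (xk it k + sk it k)
       - m_quad f psi (xk it k) (Bk it k) (sk it k)|
     <= (kubd * (1 + specnorm (Bk it k)) * enorm (sk it k) ^+ 2)%:E)%E) ->
  forall k, h (xk it k) \is a fin_num /\
    (objective f h (xk it k) <= objective f h (xk it 0))%E.
Proof.
move=> hNy model run kmdc0 mdc ubd; elim=> [|k [hfin le0]].
  by split => //; exact: run_x0 run.
rewrite (run_x run); case: ifP => [succ|//].
suff [H1 H2] : h (xk it k + sk it k) \is a fin_num /\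
    (objective f h (xk it k + sk it k)%R <= objective f h (xk it k))%E.
  by split => //; exact: le_trans H2 le0.
have [xi [xiE s1fin xi_ge _]] := cauchy_step model run hfin.
have [[psiNy _] _ psi0 _] := model _ hfin.
have /andP[nu0 _] := run_nu run k.
have := ubd k; have := mdc k; rewrite xiE.
have := run_s_decrease run k; move: succ; rewrite /successful.
have := @run_rho _ _ _ _ _ _ _ run k.
have := psiNy (sk it k).
rewrite /pred_decrease /m_quad /objective psi0 dotv0 mulmx0 dotv0.
case s1E : (psi _ (s1k it k)) s1fin => [b| |] //= _.
(* The value [+oo] is excluded because [sk] does at least as well as [s1k], where the model is
   finite. *)
case sE : (psi _ (sk it k)) => [c| |] //= _.
case hxE : (h (xk it k)) hfin => [a| |] //= _.
(* The real bound on the model error excludes [h = +oo] at the trial point. *)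
case hsE : (h (xk it k + sk it k)) (hNy (xk it k + sk it k)) => [a'| |] //= _.
rewrite -!EFinD -?EFinN -?EFinD -EFinM !lee_fin eqe.
set prd := (X in X != 0) => rho succ _ mdck _; split => //.
have {}mdck : kmdc * xi <= prd by exact: mdck.
have {}rho : prd != 0 -> rhok it k =
    ((f (xk it k) + a - (f (xk it k + sk it k) + a'))%:E / prd%:E)%E.
  by exact: rho.
have xi_ge0 : 0 <= xi.
  by apply: le_trans xi_ge; rewrite mulr_ge0 ?sqr_ge0 // mulr_ge0 ?invr_ge0 // ltW.
have prd_ge0 : 0 <= prd by apply: le_trans mdck; rewrite mulr_ge0 // ltW.
(* With a zero denominator [rhok] is arbitrary, so acceptance of the step gives no information. *)
have [prd0|prd_neq0] := eqVneq prd 0.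
  (* A vanishing predicted decrease forces xi = 0, hence s1 = 0 and s = 0. *)
  suff s0 : sk it k = 0.
    by move: hsE; rewrite s0 addr0 hxE => -[<-].
  have xi0 : xi = 0 by move: mdck; rewrite prd0; nra.
  have s10 : enorm (s1k it k) = 0.
    apply/eqP; rewrite -sqrf_eq0 eq_le sqr_ge0 andbT.
    have q0 : 0 < 2^-1 * (nuk it k)^-1 by rewrite mulr_gt0 ?invr_gt0.
    by rewrite -(pmulr_rle0 _ q0) -xi0.
  apply/eqP; rewrite -enorm_eq0 eq_le enorm_ge0 andbT.
  have := run_s_feasible run k.
  by rewrite s10 mulr0 le_min => /andP[_].
have prd_gt0 : 0 < prd by rewrite lt_neqAle eq_sym prd_neq0.
(* Acceptance now means an actual decrease of at least [eta1 P * prd], which is nonnegative. *)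
move: succ; rewrite (rho prd_neq0) inver (negbTE prd_neq0) -EFinM lee_fin.
rewrite ler_pdivlMr // => h1; rewrite -subr_ge0; apply: le_trans h1.
by rewrite mulr_ge0 // ltW // (eta1_gt0 P).
Qed.

(** The denominator of [nu_bound] is at least 1. This keeps the radii away from 0 whenever [nuk]
    is. *)
Lemma nuk_le (k : nat) :
  tr_run f h psi P it -> nuk it k <= alpha P * Deltak it k.
Proof.
move=> run; have /andP[_ /le_trans] := run_nu run k; apply.
have Delta_ge0 : 0 <= Deltak it k.
  exact: le_trans (enorm_ge0 _) (run_s1_feasible run k).
have aD_ge0 : 0 <= alpha P * Deltak it k by rewrite mulr_ge0 // ltW // alpha_gt0.
have q0 : 0 <= specnorm (Bk it k) * (1 + alpha P * Deltak it k).
  by rewrite mulr_ge0 ?specnorm_ge0 ?addr_ge0.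
rewrite /nu_bound ler_pdivrMr; first by rewrite ler_peMr // lerDl.
by rewrite ltr_pwDl.
Qed.

End Run.

(** * Passage to the limit along [N1] *)

Theorem theorem3p12 (R : realType) (n : nat)
  (f : 'cV[R]_n -> R) (h : 'cV[R]_n -> \bar R)
  (psi : 'cV[R]_n -> 'cV[R]_n -> \bar R)
  (P : tr_params R) (it : tr_iterates R n)
  (kmdc kubd mu p : R) (N N1 : set nat)
  (nubar : R) (xbar : 'cV[R]_n) (psibar : 'cV[R]_n -> \bar R) :
  continuously_differentiable f ->
  proper h -> lower_semicontinuous h ->
  is_model h psi ->
  tr_run f h psi P it ->
  (forall k, nuk it k = nu_bound P it k) ->
  (* (i) *)
  0 < kmdc < 1 ->
  (forall k,
    (kmdc%:E * xi_cp f h psi it k <= pred_decrease f psi it k)%E) ->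
  (* (ii) *)
  0 < kubd ->
  (forall k,
    (`|objective f h (xk it k + sk it k)
       - m_quad f psi (xk it k) (Bk it k) (sk it k)|
     <= (kubd * (1 + specnorm (Bk it k)) * enorm (sk it k) ^+ 2)%:E)%E) ->
  (* (iii) *)
  0 < mu -> 0 < p < 1 ->
  (forall k,
    \big[Num.max/0]_(j < k.+1) specnorm (Bk it j)
      <= mu * (1 + (sigma P it k)%:R `^ p)) ->
  (* (iv) *)
  infinite_set [set k | successful P it k] ->
  (\forall eps \near 0^'+,
    ((mu + 1)%:E <= mu%:E * counting (S_eps f h psi P it eps) `^ p)%E) ->
  (* (v) *)
  (exists M : R, forall k, (M%:E <= objective f h (xk it k))%E) ->
  infinite_set N ->
  criticality f h psi it @ within N \oo --> (0 : R) ->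
  (fun k => (nuk it k)^-1 *: s1k it k) @ within N \oo --> (0 : 'cV[R]_n) ->
  s1k it @ within N \oo --> (0 : 'cV[R]_n) ->
  sk it @ within N \oo --> (0 : 'cV[R]_n) ->
  N1 `<=` N -> infinite_set N1 ->
  nuk it @ within N1 \oo --> nubar -> 0 < nubar ->
  xk it @ within N1 \oo --> xbar ->
  is_epi_limit N1 (fun k => psi (xk it k)) psibar ->
  proper psibar -> lower_semicontinuous psibar ->
  psibar 0 = h xbar ->
  limiting_subdiff psibar 0 `<=` limiting_subdiff h xbar ->
  (-oo < ereal_inf (range psibar) < +oo)%E ->
  (forall s, (fun k => psi (xk it k) s) @ within N1 \oo --> psibar s) ->
  stationary f h xbar.
Proof.
move=> [fdiff gradf_cont] [hNy _] _ model run _ /andP[kmdc0 _] mdc _ ubd _ _ _ _ _ _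
  _ crit0 _ _ _ N1N N1inf nu_cvg nubar0 x_cvg _ [psibarNy _] _ psibar0 sub _ psi_cvg.
have FF := within_infinite_proper N1inf.
have {}crit0 : criticality f h psi it @ within N1 \oo --> (0 : R).
  have subN : within N1 \oo --> within N \oo.
    by move=> A [M _ MA]; exists M => // k Mk /N1N; exact: MA.
  exact: cvg_trans (cvg_app _ subN) crit0.
have f_cvg : f (xk it k) @[k --> within N1 \oo] --> f xbar.
  by apply: (cvg_comp _ f x_cvg); exact: (differentiable_continuous (fdiff xbar)).
have grad_cvg : grad f (xk it k) @[k --> within N1 \oo] --> grad f xbar.
  by apply: (cvg_comp _ (grad f) x_cvg); exact: gradf_cont.
have mono := objective_nonincreasing hNy model run kmdc0 mdc ubd.
have hfin k : h (xk it k) \is a fin_num := (mono k).1.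
have nu_gt0 k : 0 < nuk it k by have /andP[] := run_nu run k.
(* Since [psi x 0 = h x], this is the pointwise convergence of the models at [s = 0]. *)
have h_cvg : h (xk it k) @[k --> within N1 \oo] --> h xbar.
  rewrite -psibar0; apply: cvg_trans (psi_cvg 0).
  by apply: near_eq_cvg; near=> k; have [] := model _ (hfin k).
have hbar_fin : h xbar \is a fin_num.
  rewrite fin_numElt hNy /=.
  have obj_cvg : objective f h (xk it k) @[k --> within N1 \oo] -->
      ((f xbar)%:E + h xbar)%E.
    by apply: cvgeD => //; apply: cvg_EFin => //; exact: nearW.
  have : ((f xbar)%:E + h xbar <= objective f h (xk it 0))%E.
    by apply: (cvge_le _ obj_cvg); near=> k; exact: (mono k).2.
  rewrite /objective; move: (hfin 0%N); case: (h (xk it 0)) => //= r _.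
  by case: (h xbar) => [b||] //=; rewrite ?ltry ?ltNyr ?leye_eq.
pose xi k := fine (xi_cp f h psi it k).
have xi_cvg : xi k @[k --> within N1 \oo] --> (0 : R).
  rewrite -[X in _ --> X](mulr0 nubar) -[X in _ * X](mulr0 (0 : R)).
  (* Undoing the square root in [criticality] requires [xi k] to be nonnegative, which the Cauchy
     step provides. *)
  have xiE : (fun k => nuk it k * (criticality f h psi it k
                                   * criticality f h psi it k)) = xi.
    apply/funext => k; rewrite /criticality -/(xi k).
    have [r [xirE _ r_ge _]] := cauchy_step model run (hfin k).
    have xi_ge0 : 0 <= xi k.
      rewrite /xi xirE; apply: le_trans r_ge.
      by rewrite mulr_ge0 ?sqr_ge0 // mulr_ge0 ?invr_ge0 // ltW.
    rewrite mulrACA -!expr2 exprVn !sqr_sqrtr // ?(ltW (nu_gt0 k)) //.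
    by rewrite mulrA divff ?mul1r // gt_eqF.
  by rewrite -xiE; apply: cvgM => //; exact: cvgM.
have alpha0 := alpha_gt0 P.
(* Eventually [nuk] is at least [nubar / 2], so every [s] within this radius is feasible for the
   Cauchy problem. *)
have d0 : 0 < nubar / 2 / alpha P by rewrite !divr_gt0.
exists (- grad f xbar); last by rewrite addrN.
apply: sub; apply: regular_sub_limiting.
have c0 : 0 < 2^-1 * nubar^-1 by rewrite mulr_gt0 ?invr_gt0.
apply: (regular_subdiff_quadratic _ c0 d0); first by rewrite psibar0.
move=> s sd; rewrite add0r psibar0 dotvNl opprK.
have rhs_cvg : ((xi k + dotv (grad f (xk it k)) s
                 + 2^-1 * (nuk it k)^-1 * enorm s ^+ 2)%:E + psi (xk it k) s)%E
    @[k --> within N1 \oo] -->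
    ((2^-1 * nubar^-1 * enorm s ^+ 2 + dotv (grad f xbar) s)%:E + psibar s)%E.
  apply: cvgeD => //; apply: cvg_EFin; first exact: nearW.
  rewrite addrC -[X in X + _]add0r; apply: cvgD.
    by apply: cvgD => //; apply: cvg_dotv => //; exact: cvg_cst.
  apply: cvgMr_tmp; apply: cvgMl_tmp; apply: cvgV => //; exact: lt0r_neq0.
(* The limit is taken in the difference of the two sides; it is well defined because [h xbar] is
   finite, even if [psibar s] is [+oo]. *)
rewrite -sube_ge0 ?hbar_fin ?orbT //.
apply: cvge_ge (cvgeB _ rhs_cvg h_cvg); last first.
  by apply: fin_num_adde_defl; rewrite fin_numN.
near=> k; rewrite sube_ge0 ?hfin ?orbT //.
have [r [xirE _ _ r_le]] := cauchy_step model run (hfin k).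
rewrite /xi xirE; apply: r_le; apply: (le_trans sd).
rewrite ler_pdivrMr // [_ * alpha P]mulrC; apply: le_trans (nuk_le k run).
near: k; apply: cvgr_ge nu_cvg _ _; lra.
Unshelve. all: by end_near.
Qed.
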